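(* Let $k$ be a kernel with unbounded support $S$ such that the following conditions are satisfied, for some number $N\in\mathbb{N}_0$. (i) For all $j,l\in S$ with $\max\{|j|,|l|\}>N$ we have $j+l\notin S$. (ii) For every $m\in\mathbb{N}$ with $m>2N$ there exists at most one decomposition (up to the order of the summands) $m=j+l$ with $j,l\in S$. (iii) For every $m\in\mathbb{N}$ with $m\le2N$ there exist at most finitely many decompositions of the form $m=j+l$ with $j,l\in S$. Then the operator $\mathcal{L}$ associated with $k$ fails to satisfy $CD(0,d)$ for all finite $d>0$.
   Context: $\mathbb{N}=\{1,2,\dots\}$, $\mathbb{N}_0=\mathbb{N}\cup\{0\}$. A kernel is a function $k:\mathbb{Z}\to[0,\infty)$ with $k(0)=0$, $k(-j)=k(j)$ for all $j\in\mathbb{N}$, and $0<|k|_1:=\sum_{j\in\mathbb{Z}}k(j)<\infty$; its support is $\{j\in\mathbb{Z}:k(j)\ne0\}$. The associated operator is $\mathcal{L}u(x)=\sum_{j\in\mathbb{Z}}k(j)\big(u(x+j)-u(x)\big)$, $x\in\mathbb{Z}$, and the iterated carré du champ operator is given by $\Gamma_2(u)(x)=\frac14\sum_{j,l\in\mathbb{Z}}k(j)k(l)\big(u(x+j+l)-u(x+j)-u(x+l)+u(x)\big)^2\in[0,\infty]$. A function $u:\mathbb{Z}\to\mathbb{R}$ is admissible for $CD(0,d)$ at $x\in\mathbb{Z}$ if $\sum_{j\in\mathbb{Z}}k(j)|u(x+j)|<\infty$. For $d\in(0,\infty)$, $\mathcal{L}$ satisfies $CD(0,d)$ if $\Gamma_2(u)(x)\ge\frac1d\big(\mathcal{L}u(x)\big)^2$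 for every $x\in\mathbb{Z}$ and every $u$ admissible at $x$; it fails to satisfy $CD(0,d)$ if this does not hold. *)

(* Defs.v *)
From mathcomp Require Import all_boot all_order all_algebra.
From mathcomp Require Import all_classical all_reals all_analysis.

Set Implicit Arguments.
Unset Strict Implicit.
Unset Printing Implicit Defensive.

Import Order.TTheory GRing.Theory Num.Theory.

Local Open Scope classical_set_scope.
Local Open Scope ring_scope.

Definition norm1 (R : realType) (k : int -> R) : \bar R :=
  (\esum_(j in [set: int]) (k j)%:E)%E.

Definition is_kernel (R : realType) (k : int -> R) : Prop :=
  [/\ forall j, 0 <= k j,
      k 0 = 0,
      forall j : nat, (0 < j)%N -> k (- j%:Z) = k j%:Z,
      (0 < norm1 k)%E &
      (norm1 k < +oo)%E].

Definition ksupport (R : realType) (k : int -> R) : set int :=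
  [set j | k j <> 0].

Definition unboundedZ (S : set int) : Prop :=
  forall M : nat, exists2 j, S j & (M < `|j|)%N.

(* [esum] is only meaningful for nonnegative terms, so an absolutely convergent
   real series over Z is summed through its positive and negative parts. The
   value is a junk one if the series is not absolutely convergent. *)
Definition sumZ (R : realType) (f : int -> R) : R :=
  fine (esum [set: int] (EFin \o f)^\+%E - esum [set: int] (EFin \o f)^\-%E).

Definition Lop (R : realType) (k u : int -> R) (x : int) : R :=
  sumZ (fun j => k j * (u (x + j) - u x)).

Definition Gamma2 (R : realType) (k u : int -> R) (x : int) : \bar R :=
  ((4^-1)%:E * \esum_(p in [set: int * int])
     (k p.1 * k p.2 *
        (u (x + p.1 + p.2) - u (x + p.1) - u (x + p.2) + u x) ^+ 2)%:E)%E.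

(* For a kernel [k], admissibility at [x] makes the series defining
   [Lop k u x] absolutely convergent. *)
Definition admissible (R : realType) (k u : int -> R) (x : int) : Prop :=
  (\esum_(j in [set: int]) (k j * `|u (x + j)|)%:E < +oo)%E.

Definition CD0 (R : realType) (k : int -> R) (d : R) : Prop :=
  forall (x : int) (u : int -> R), admissible k u x ->
    ((d^-1 * Lop k u x ^+ 2)%:E <= Gamma2 k u x)%E.

(* Ordered decompositions; the summands may be negative. *)
Definition decompositions (S : set int) (m : int) : set (int * int) :=
  [set p | [/\ S p.1, S p.2 & m = p.1 + p.2]].

(* Main.v *)
Require Import Defs.
From mathcomp Require Import all_boot all_order all_algebra.
From mathcomp Require Import all_classical all_reals all_analysis.
From mathcomp Require Import zify ring lra.

Set Implicit Arguments.
Unset Strict Implicit.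
Unset Printing Implicit Defensive.

Import Order.TTheory GRing.Theory Num.Theory.

Local Open Scope classical_set_scope.
Local Open Scope ring_scope.

(** The inequality is violated at [x = 0] by functions whose iterated carré du
    champ sees almost nothing.  Call [m] far if [`|m| > 2 N].  Prescribe a weight
    [w] on the support [S] of [k], supported on a finite set [A] of large
    positive elements of [S], and extend it to far points [m] outside [S] by
    [u (j + l) := w j + w l]: by (ii) there is at most one way to do this, so no
    conflict arises; everywhere else [u] is [w].  Then the second difference
    [u (j + l) - u j - u l + u 0] vanishes for all [j, l] in [S] with
    [j + l != 0].  If [j + l] is far, then [j] or [l] exceeds [N] in absolute
    value, so [j + l] is outside [S] by (i), and the difference vanishes by the
    choice of [u] ([additive_extensionD]).  If [0 < `|j + l| <= 2 N], then by
    (iii) only finitely many [j], [l] are concerned, and [A] is chosen beyond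
    [2 N] and beyond all of them, so that all four values are zero
    ([near_decompositions_bounded], [additive_extension_sum]).

    Only the pairs [(a, -a)] and [(-a, a)] with [a] in [A] remain. With
    [w = 1 / k] on [A] each of them contributes [1] to the double sum, whence
    [Gamma2 u 0 = n / 2] for [n = #|A|], whereas [L u 0 = n], the values of [u]
    outside [S] being invisible to [L].  So [CD(0,d)] would give
    [n ^ 2 / d <= n / 2] for every [n], which is absurd. *)

Lemma esum_mem_seq (R : realType) (T : choiceType) (s : seq T) : uniq s ->
  (\esum_(i in [set: T]) ((i \in s)%:R : R)%:E = (size s)%:R%:E)%E.
Proof.
move=> us; transitivity (\esum_(i in [set` s]) (1 : \bar R))%E.
  rewrite [RHS]esum_mkcond; apply: eq_esum => i _.
  by rewrite mem_setE; case: (i \in s).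
rewrite esum_fset //.
rewrite -fsbig_seq // sumEFin; congr (_%:E).
by rewrite big_const_seq count_predT iter_addr_0.
Qed.

Lemma sumZ_mem_seq (R : realType) (s : seq int) : uniq s ->
  sumZ (fun j => (j \in s)%:R : R) = (size s)%:R.
Proof.
move=> us; rewrite /sumZ.
set f := EFin \o _.
have f0 i : [set: int] i -> (0 <= f i)%E by rewrite lee_fin ler0n.
have -> : f^\+%E = f by apply/funext => i; rewrite (ge0_funeposE f0) ?in_setT.
rewrite (esum1 (a := f^\-%E)) => [|i _]; last by rewrite (ge0_funenegE f0) ?in_setT.
by rewrite sube0 esum_mem_seq.
Qed.

Lemma kernel_even (R : realType) (k : int -> R) : is_kernel k ->
  forall j, k (- j) = k j.
Proof.
case=> _ _ kN _ _ [[|n]|n]; first by rewrite oppr0.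
  exact: kN.
by rewrite NegzE opprK [RHS]kN.
Qed.

Lemma ksupportN (R : realType) (k : int -> R) : is_kernel k ->
  forall j, ksupport k j -> ksupport k (- j).
Proof. by move=> hk j; rewrite /ksupport /= kernel_even. Qed.

Lemma unbounded_far_seq (S : set int) (M n : nat) :
  (forall j, S j -> S (- j)) -> unboundedZ S ->
  exists s : seq int,
    [/\ uniq s, size s = n & forall a, a \in s -> S a /\ M%:Z < a].
Proof.
move=> SN Sunb; elim: n M => [|n IH] M; first by exists [::].
have [j Sj jM] := Sunb M.
have Sabs : S `|j|%N%:Z.
  by case: j Sj {jM} => // m /SN; rewrite NegzE opprK.
have [s [us sz sS]] := IH `|j|%N.
exists (`|j|%N%:Z :: s); split=> /=; last 1 first.
- move=> a; rewrite inE => /orP[/eqP->|/sS[Sa ja]]; split => //; lia.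
- rewrite us andbT; apply/negP => /sS[_]; lia.
- by rewrite sz.
Qed.

Lemma finite_pairs_bounded (D : set (int * int)) : finite_set D ->
  exists M : nat, forall p, D p -> (`|p.1| <= M)%N /\ (`|p.2| <= M)%N.
Proof.
case/finite_seqP => s ->; exists (\max_(p <- s) maxn `|p.1| `|p.2|).
by move=> p ps; apply/andP; rewrite -geq_max; exact: leq_bigmax_seq.
Qed.

Lemma decompositionsN (S : set int) (m : int) (p : int * int) :
  (forall j, S j -> S (- j)) ->
  decompositions S m p -> decompositions S (- m) (- p.1, - p.2).
Proof. by move=> SN [? ? ->]; split; [exact: SN..|rewrite opprD]. Qed.

(** By the symmetry of the support, hypothesis (iii) also controls negative
    sums, so that all decompositions of nonzero near points are bounded at
    once. *)
Lemma near_decompositions_bounded (S : set int) (B : nat) :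
  (forall j, S j -> S (- j)) ->
  (forall m : nat, (0 < m)%N -> (m <= B)%N ->
     finite_set (decompositions S m%:Z)) ->
  exists M : nat, forall m p, m != 0 -> (`|m| <= B)%N ->
    decompositions S m p -> (`|p.1| <= M)%N /\ (`|p.2| <= M)%N.
Proof.
move=> SN fin.
have [] := @finite_pairs_bounded
  (\bigcup_(m in [set m : nat | (0 < m <= B)%N]) decompositions S m%:Z).
  apply: bigcup_finite => [|m /= /andP[m0 mB]]; last exact: fin.
  apply: (@sub_finite_set _ _ `I_B.+1); last exact: finite_II.
  by move=> m /= /andP[].
move=> M HM; exists M => -[m|m] p m0 mB Dp.
  by apply: HM; exists m => //=; lia.
have := HM (- p.1, - p.2); rewrite /= !abszN; apply.
exists m.+1 => /=; first lia.
by have := decompositionsN SN Dp; rewrite NegzE opprK.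
Qed.

Lemma far_decompositions_unique (S : set int) (B : nat) :
  (forall j, S j -> S (- j)) ->
  (forall m : nat, (0 < m)%N -> (B < m)%N -> forall p q,
     decompositions S m%:Z p -> decompositions S m%:Z q ->
     q = p \/ q = (p.2, p.1)) ->
  forall m p q, (B < `|m|)%N -> decompositions S m p -> decompositions S m q ->
    q = p \/ q = (p.2, p.1).
Proof.
move=> SN uniqS [m|m] p q mB Dp Dq; first by apply: (uniqS m) => //; lia.
have := decompositionsN SN Dp; have := decompositionsN SN Dq.
rewrite NegzE opprK => Dq' Dp'.
have := uniqS m.+1 isT mB _ _ Dp' Dq'.
by case: p q {Dp Dq Dp' Dq'} => [a b] [c d] /= [] [/oppr_inj-> /oppr_inj->]; [left|right].
Qed.

(** Off [S] and far from [0], the value is forced by additivity along a chosen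
    decomposition; points without decomposition get the harmless value
    [w 0 + w 0]. *)
Definition additive_extension (R : realType) (S : set int) (B : nat)
    (w : int -> R) (m : int) : R :=
  if `[< S m >] || (`|m| <= B)%N then w m
  else let p := xget (0, 0) (decompositions S m) in w p.1 + w p.2.

Lemma additive_extension_id (R : realType) (S : set int) (B : nat)
    (w : int -> R) (m : int) :
  S m -> additive_extension S B w m = w m.
Proof. by move=> Sm; rewrite /additive_extension asboolT. Qed.

Lemma additive_extension_near (R : realType) (S : set int) (B : nat)
    (w : int -> R) (m : int) :
  (`|m| <= B)%N -> additive_extension S B w m = w m.
Proof. by move=> mB; rewrite /additive_extension mB orbT. Qed.

Lemma additive_extensionD (R : realType) (S : set int) (B : nat)
    (w : int -> R) (j l : int) :
  (forall m p q, (B < `|m|)%N -> decompositions S m p ->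
     decompositions S m q -> q = p \/ q = (p.2, p.1)) ->
  S j -> S l -> ~ S (j + l) -> (B < `|(j + l)%R|)%N ->
  additive_extension S B w (j + l) = w j + w l.
Proof.
move=> uniqS Sj Sl Sjl far.
rewrite /additive_extension asboolF //= leqNgt far /=.
have Djl : decompositions S (j + l) (j, l) by [].
have Dx := xgetI (0, 0) Djl.
by have [->//|->/=] := uniqS _ _ _ far Djl Dx; rewrite addrC.
Qed.

(** The cancellation at the heart of the argument.  A nonzero near sum and its
    summands all lie within [M], where [w] vanishes, so both sides are zero; a
    far sum has a summand larger than [N] in absolute value, so it leaves [S] by
    sum-freeness, and additivity was imposed there. *)
Lemma additive_extension_sum (R : realType) (S : set int)
    (N M : nat) (w : int -> R) (j l : int) :
  (forall j l, S j -> S l -> (N < maxn `|j| `|l|)%N -> ~ S (j + l)) ->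
  (forall m p q, (2 * N < `|m|)%N -> decompositions S m p ->
     decompositions S m q -> q = p \/ q = (p.2, p.1)) ->
  (forall m p, m != 0 -> (`|m| <= 2 * N)%N ->
    decompositions S m p -> (`|p.1| <= M)%N /\ (`|p.2| <= M)%N) ->
  (2 * N <= M)%N -> (forall i, (`|i| <= M)%N -> w i = 0) ->
  S j -> S l -> j + l != 0 ->
  additive_extension S (2 * N) w (j + l) = w j + w l.
Proof.
move=> sumfree uniqS nearM NM wM Sj Sl jl0.
have [near|far] := leqP `|(j + l)%R|%N (2 * N).
  rewrite additive_extension_near //.
  have [/= jM lM] := nearM _ (j, l) jl0 near (And3 Sj Sl erefl).
  by rewrite !wM ?addr0 //; exact: leq_trans NM.
apply: additive_extensionD => //; apply: sumfree => //.
lia.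
Qed.

Theorem theorem5p3 (R : realType) (k : int -> R) (N : nat)
  (hk : is_kernel k)
  (hS : unboundedZ (ksupport k))
  (h1 : forall j l : int, ksupport k j -> ksupport k l ->
     (N < maxn `|j| `|l|)%N -> ~ ksupport k (j + l))
  (h2 : forall m : nat, (0 < m)%N -> (2 * N < m)%N ->
     forall p q : int * int,
       decompositions (ksupport k) m%:Z p ->
       decompositions (ksupport k) m%:Z q ->
       q = p \/ q = (p.2, p.1))
  (h3 : forall m : nat, (0 < m)%N -> (m <= 2 * N)%N ->
     finite_set (decompositions (ksupport k) m%:Z)) :
  forall d : R, 0 < d -> ~ CD0 k d.
Proof.
move=> d d0 cd.
have SN := ksupportN hk.
have uniqS := far_decompositions_unique SN h2.
have [M0 nearM0] := near_decompositions_bounded SN h3.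
pose M := maxn M0 (2 * N).
have nearM m p : m != 0 -> (`|m| <= 2 * N)%N ->
    decompositions (ksupport k) m p -> (`|p.1| <= M)%N /\ (`|p.2| <= M)%N.
  by move=> m0 mN /(nearM0 _ _ m0 mN)[? ?]; rewrite /M; lia.
(* The final estimate [n ^ 2 / d <= n / 2] fails as soon as [d < n]. *)
pose n := (Num.truncn d).+1.
have [s [us sz sS]] := unbounded_far_seq M n SN hS.
(* The weight [1 / k] makes each point of [s] contribute [1] to [L u 0], however
   small [k] is there. *)
pose w j := if j \in s then (k j)^-1 else 0.
have wM i : (`|i| <= M)%N -> w i = 0.
  by rewrite /w; case: ifPn => // /sS[_]; lia.
pose u := additive_extension (ksupport k) (2 * N) w.
have u0 : u 0 = 0 by rewrite /u additive_extension_near // wM.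
have uD := additive_extension_sum h1 uniqS nearM
  (leq_maxr _ _) wM.
have ku j : k j * u j = (j \in s)%:R.
  have [Sj|/contrapT kj0] := pselect (ksupport k j).
    rewrite /u additive_extension_id // /w; case: ifP => _; last exact: mulr0.
    by rewrite divff //; apply/eqP.
  by rewrite kj0 mul0r; case: (boolP (j \in s)) => // /sS[].
have Lu : Lop k u 0 = n%:R.
  rewrite /Lop u0 -sz -sumZ_mem_seq //; congr sumZ; apply/funext => j.
  by rewrite add0r subr0 ku.
have adm : admissible k u 0.
  rewrite /admissible (eq_esum (b := fun j => ((j \in s)%:R : R)%:E)).
    by rewrite esum_mem_seq // ltry.
  move=> j _; congr (_%:E); rewrite add0r -(ger0_norm (_ : 0 <= k j)).
    by rewrite -normrM ku ger0_norm // ler0n.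
  by case: hk.
pose t := [seq (a, - a) | a <- s] ++ [seq (- a, a) | a <- s].
have ut : uniq t.
  have inj1 : injective (fun a : int => (a, - a)) by move=> ? ? [].
  have inj2 : injective (fun a : int => (- a, a)) by move=> ? ? [].
  rewrite cat_uniq (map_inj_uniq inj1) (map_inj_uniq inj2) us andbT /=.
  apply/hasPn => _ /mapP[a /sS[_ aM] ->].
  apply/negP => /mapP[b /sS[_ bM]] [].
  by lia.
have memt p : (p \in t) = (p.1 + p.2 == 0) && ((p.1 \in s) || (p.2 \in s)).
  case: p => a b; rewrite mem_cat /=; apply/idP/idP.
    by case/orP => /mapP[c cs [-> ->]]; rewrite cs ?subrr ?addNr ?orbT.
  rewrite addr_eq0 => /andP[/eqP-> /orP[] bs]; apply/orP.
    by left; apply/mapP; exists (- b); rewrite ?opprK.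
  by right; apply/mapP; exists b.
have G2 : Gamma2 k u 0 = (4^-1 * (n + n)%:R)%:E.
  rewrite /Gamma2 EFinM; congr (_ * _)%E.
  have -> : (n + n)%N = size t by rewrite size_cat !size_map sz.
  rewrite -esum_mem_seq //; apply: eq_esum => -[j l] _ /=; congr (_%:E).
  rewrite !add0r u0 addr0 memt /=.
  have [jl0|jl0] := eqVneq (j + l) 0; last first.
    have [Sj|/contrapT ->] := pselect (ksupport k j); last by rewrite !mul0r.
    have [Sl|/contrapT ->] := pselect (ksupport k l); last by rewrite mulr0 mul0r.
    rewrite [u (j + l)]uD // /u !additive_extension_id //=.
    by ring.
  have jE : j = - l by apply/eqP; rewrite -addr_eq0 jl0.
  have kjE : k j = k l by rewrite jE kernel_even.
  rewrite jl0 u0 sub0r.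
  transitivity ((k j * u j + k l * u l) ^+ 2); first by rewrite kjE; ring.
  rewrite !ku /=.
  (* Two opposite points are never both in [s], whose elements are positive. *)
  case: (boolP (j \in s)) (sS j) => [_ /(_ isT)[_ jM]|_ _]; last first.
    by case: (l \in s); rewrite ?add0r ?expr1n ?expr0n.
  case: (boolP (l \in s)) (sS l) => [_ /(_ isT)[_ lM]|_ _]; first lia.
  by rewrite addr0 expr1n.
have := cd 0 u adm.
rewrite Lu G2 lee_fin natrD => cdn.
have n0 : (0 : R) < n%:R by rewrite ltr0n.
have dn : d < n%:R by apply: truncnS_gt.
move: cdn; rewrite mulrC ler_pdivrMr //.
nra.
Qed.
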